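(* Let $\lambda$ be a partition of $n\geq 1$ other than $(1,\ldots,1)$. Then the dimension of the Specht polytope $P(\lambda)$ equals the dimension of the Specht module $V(\lambda)$.
   Context: A word of length $n$ is a sequence of $n$ letters; $S_n$ acts on words of length $n$ by permuting positions, $(\sigma w)_i=w_{\sigma^{-1}(i)}$. A rearrangement of $w$ is an element of its $S_n$-orbit. Words $w_1,w_2$ of the same length $n$ have complementary rearrangements if the diagonal action of $S_n$ on $\{\text{rearrangements of }w_1\}\times\{\text{rearrangements of }w_2\}$ has exactly one free orbit (an orbit whose points have trivial stabilizer); they are complementary if moreover $(w_1,w_2)$ lies in that free orbit. A complementary pair $(w_1,w_2)$ corresponds to the partition $\lambda$ of $n$ if, for every $j\ge1$, the $j$-th most common letter of $w_1$ occurs $\lambda_j$ times in $w_1$ and the $j$-th most common letter of $w_2$ occurs $\lambda^*_j$ times in $w_2$, where $\lambda^*_j=\#\{k:\lambda_k\ge j\}$ is the conjugate partition. Such a pair exists for every $\lambda$. Young's character: $\mathrm{Y}_{w_1,w_2}(r_1,r_2)=\sum_\sigma \mathrm{sign}(\sigma)$, the sum over all $\sigma\in S_n$ with $\sigma w_1=r_1$ and $\sigma w_2=r_2$. The Specht matrix for $\lambda$ has rows indexed by rearrangements $r_1$ of $w_1$, columns indexed by rearrangements $r_2$ of $w_2$, and entries $\mathrm{Y}_{w_1,w_2}(r_1,r_2)$, where $(w_1,w_2)$ is a complementary pair corresponding to $\lambda$ (the matrix is determined up to relabelling and a global sign). The Specht module $V(\lambda)$ is the column span (over $\mathbb{C}$)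 of this matrix. The Specht polytope $P(\lambda)$ is the convex hull of the columns of this matrix in $\mathbb{R}^N$, where $N$ is the number of rearrangements of $w_1$. The dimension of a polytope is the dimension of its affine hull. *)

(* Defs.v *)
From mathcomp Require Import all_boot all_order all_algebra all_fingroup.
From mathcomp Require Import boolp classical_sets reals.
From mathcomp.real_closed Require Import complex.

Set Implicit Arguments.
Unset Strict Implicit.
Unset Printing Implicit Defensive.

Import Order.TTheory GRing.Theory Num.Theory.

Local Open Scope ring_scope.

(* No loss in a finite alphabet: a word uses finitely many letters, and letters
   that do not occur only add trailing zeros to [multiplicities]. *)
Definition word (n : nat) (T : finType) := {ffun 'I_n -> T}.

Section Action.
Variable n : nat.

Section Word.
Variable T : finType.

Definition word_act (w : word n T) (s : 'S_n) : word n T :=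
  [ffun i => w ((s^-1)%g i)].

Lemma word_act1 : word_act^~ 1%g =1 id.
Proof. by move=> w; apply/ffunP=> i; rewrite ffunE invg1 perm1. Qed.

Lemma word_actM (w : word n T) : act_morph word_act w.
Proof. by move=> s t; apply/ffunP=> i; rewrite !ffunE invMg permM. Qed.

(* The product of 'S_n is (s * t) i = t (s i), opposite to composition, so the
   left action of the symmetric group is a right action of 'S_n. *)
Canonical word_action := TotalAction word_act1 word_actM.

Definition rearrangements (w : word n T) : {set word n T} :=
  orbit word_action [set: 'S_n] w.

(* Numbers of occurrences of the letters, the most common letter first. *)
Definition multiplicities (w : word n T) : seq nat :=
  sort geq [seq #|[set i | w i == a]| | a <- enum T].

End Word.

Section Pair.
Variables T1 T2 : finType.

Definition pair_act (x : word n T1 * word n T2) (s : 'S_n) :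
    word n T1 * word n T2 :=
  (word_act x.1 s, word_act x.2 s).

Lemma pair_act1 : pair_act^~ 1%g =1 id.
Proof. by move=> [w1 w2]; rewrite /pair_act /= !word_act1. Qed.

Lemma pair_actM x : act_morph pair_act x.
Proof. by move=> s t; rewrite /pair_act /= !word_actM. Qed.

Canonical pair_action := TotalAction pair_act1 pair_actM.

Definition free_orbits (w1 : word n T1) (w2 : word n T2) :
    {set {set word n T1 * word n T2}} :=
  [set O in orbit pair_action [set: 'S_n]
              @: finset.setX (rearrangements w1) (rearrangements w2)
     | [forall x in O, 'C[x | pair_action]%g == 1%g]].

Definition have_complementary_rearrangements
    (w1 : word n T1) (w2 : word n T2) : Prop :=
  #|free_orbits w1 w2| = 1%N.

Definition complementary (w1 : word n T1) (w2 : word n T2) : Prop :=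
  have_complementary_rearrangements w1 w2 /\
  orbit pair_action [set: 'S_n] (w1, w2) \in free_orbits w1 w2.

End Pair.
End Action.

Definition is_partition (n : nat) (lam : seq nat) : bool :=
  [&& sorted geq lam, 0%N \notin lam & sumn lam == n].

(* Parts are indexed from 0: [conj_part lam j] is the (j+1)-st part of the
   conjugate partition. *)
Definition conj_part (lam : seq nat) (j : nat) : nat :=
  count (fun k => (j.+1 <= k)%N) lam.

Definition corresponds_to (n : nat) (T1 T2 : finType)
    (w1 : word n T1) (w2 : word n T2) (lam : seq nat) : Prop :=
  forall j : nat,
    nth 0%N (multiplicities w1) j = nth 0%N lam j /\
    nth 0%N (multiplicities w2) j = conj_part lam j.

Section Specht.
Variables (n : nat) (T1 T2 : finType) (w1 : word n T1) (w2 : word n T2).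

Definition young_character (r1 : word n T1) (r2 : word n T2) : int :=
  \sum_(s : 'S_n | (word_act w1 s == r1) && (word_act w2 s == r2)) (-1) ^+ s.

Definition specht_matrix (K : pzRingType) :
    'M[K]_(#|rearrangements w1|, #|rearrangements w2|) :=
  \matrix_(i, j) (young_character (enum_val i) (enum_val j))%:~R.

End Specht.

Section AffineGeometry.
Variables (R : realType) (V : vectType R).

Definition convex_hull (A : set V) : set V :=
  [set x | exists m (p : 'I_m -> V) (c : 'I_m -> R),
     [/\ forall i, A (p i), forall i, 0 <= c i,
         \sum_i c i = 1 & x = \sum_i c i *: p i]]%classic.

Definition affine_hull (A : set V) : set V :=
  [set x | exists m (p : 'I_m -> V) (c : 'I_m -> R),
     [/\ forall i, A (p i), \sum_i c i = 1 & x = \sum_i c i *: p i]]%classic.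

Definition is_direction (A : set V) (U : {vspace V}) : Prop :=
  exists v : V, affine_hull A = [set v + u | u in [set u | u \in U]]%classic.

(* The subspace of which the affine hull of [A] is a translate; it exists and
   is unique when [A] is nonempty, see [directionP] and [is_direction_inj]. *)
Definition direction (A : set V) : {vspace V} :=
  xget 0%VS [set U | is_direction A U]%classic.

Definition affine_dim (A : set V) : nat := \dim (direction A).

Lemma is_direction_inj (A : set V) (U U' : {vspace V}) :
  is_direction A U -> is_direction A U' -> U = U'.
Proof.
suff sub (W W' : {vspace V}) :
    is_direction A W -> is_direction A W' -> (W <= W')%VS.
  by move=> dU dU'; apply/eqP; rewrite eqEsubv !sub.
move=> [v eqv] [v']; rewrite eqv => {}eqv; apply/subvP=> u uW.
have in' z : z \in W -> v + z - v' \in W'.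
  move=> zW; have : [set v + u | u in [set u | u \in W]]%classic (v + z).
    by exists z.
  by rewrite eqv => -[y yW' <-]; rewrite addrC addKr.
have -> : u = (v + u - v') - (v + 0 - v').
  by rewrite addr0 opprB addrA subrK addrC addKr.
by rewrite rpredB ?in' ?mem0v.
Qed.

Lemma directionP (A : set V) : (A !=set0)%classic ->
  is_direction A (direction A).
Proof.
move=> [a Aa]; apply: (@xgetPex _ 0%VS [set U | is_direction A U]%classic).
pose P d := `[< exists s : seq V, (forall x, x \in s -> A (a + x)) /\
               \dim <<s>>%VS = d >].
have exP : exists d, P d 
  by exists (\dim <<[::] : seq V>>%VS); apply/asboolP; exists [::].
have ubP d : P d -> (d <= \dim {:V})%N.
  by move=> /asboolP[s [_ <-]]; rewrite dimvS ?subvf.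
case: (ex_maxnP exP ubP) => d /asboolP[s [sA sd]] dmax.
have memU x : A x -> x - a \in <<s>>%VS.
  move=> Ax; have : P (\dim <<(x - a) :: s>>%VS).
    apply/asboolP; exists (x - a :: s); split=> // y.
    rewrite inE => /orP[/eqP->|/sA//].
    by rewrite addrC subrK.
  move/dmax; rewrite -sd => le.
  have sub : (<<s>> <= <<(x - a) :: s>>)%VS by rewrite span_cons addvSr.
  have /eqP-> : (<<s>>%VS == <<x - a :: s>>%VS) by rewrite eqEdim sub.
  by rewrite memv_span ?mem_head.
exists <<s>>%VS, a; apply/seteqP; split=> x /=.
  move=> [m [p [c [pA c1 ->]]]]; exists (\sum_i c i *: (p i - a)).
    by rewrite /= rpred_sum // => i _; rewrite rpredZ ?memU.
  rewrite (eq_bigr (fun i => c i *: p i - c i *: a)); last first.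
    by move=> i _; rewrite scalerBr.
  by rewrite sumrB -scaler_suml c1 scale1r addrC subrK.
move=> [u us <-]; have /= := coord_span (X := in_tuple s) us.
set k := fun i => coord (in_tuple s) i u => eu.
exists (size s).+1, (fun i => if unlift ord0 i is Some j then a + s`_j else a),
  (fun i => if unlift ord0 i is Some j then k j else 1 - \sum_j k j).
split.
- by move=> i; case: unlift => // j; apply: sA; rewrite mem_nth.
- rewrite big_ord_recl unlift_none [X in _ + X](eq_bigr k) ?subrK // => j _.
  by rewrite liftK.
- rewrite big_ord_recl unlift_none
    [X in _ = _ + X](eq_bigr (fun j => k j *: a + k j *: s`_j)).
    by rewrite big_split /= -scaler_suml addrA -scalerDl subrK scale1r {1}eu.
  by move=> j _; rewrite liftK scalerDr.
Qed.

End AffineGeometry.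

Section SpechtObjects.
Variables (R : realType) (n : nat) (T1 T2 : finType).
Variables (w1 : word n T1) (w2 : word n T2).

Definition specht_module : {vspace 'cV[R[i]]_#|rearrangements w1|} :=
  <<[seq col j (specht_matrix w1 w2 R[i])
       | j <- enum 'I_#|rearrangements w2|]>>%VS.

Definition specht_polytope : set 'cV[R]_#|rearrangements w1| :=
  convex_hull (range (fun j => col j (specht_matrix w1 w2 R))).

End SpechtObjects.

Arguments specht_module R {n T1 T2} w1 w2.
Arguments specht_polytope R {n T1 T2} w1 w2.

(* Main.v *)
Require Import Defs.
From mathcomp Require Import all_boot all_order all_algebra all_fingroup.
From mathcomp Require Import boolp classical_sets reals.
From mathcomp.real_closed Require Import complex.

(** A partition other than (1,...,1) forces [w1] to repeat a letter, so some
    transposition fixes [w1]. Pairing each permutation with its product by this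
    transposition cancels the sum of signs along every row of the Specht matrix:
    the columns sum to zero, so the origin is the centroid of the columns. Hence
    the affine hull of the Specht polytope is the linear span of the columns,
    and its dimension is the rank of an integer matrix, which is the same
    over the reals and over the complex numbers. *)

Set Implicit Arguments.
Unset Strict Implicit.
Unset Printing Implicit Defensive.

Import GRing.Theory Num.Theory.
Import VectorInternalTheory.

Local Open Scope ring_scope.

(** The span is the row space of [b2mx], whose rows are the coordinates of the columns. Up to a cast
    this matrix is [A^T *m P], where [P] represents transposition followed by [v2r]; this map is
    injective, so [P] preserves rank. *)
Lemma dim_span_col (K : fieldType) (m n : nat) (A : 'M[K]_(m, n)) :
  \dim <<[seq col j A | j <- enum 'I_n]>>%VS = \rank A.
Proof.
set X := [seq _ | _ <- _]; have szX : size X = n by rewrite size_map size_enum_ord.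
pose P := lin1_mx (v2r \o @trmx K 1 m).
have PE (u : 'rV[K]_m) : u *m P = v2r u^T by rewrite mul_rV_lin1.
have freeP : row_free P.
  apply: inj_row_free => v; rewrite PE => /(congr1 r2v).
  by rewrite v2rK linear0 => /(congr1 trmx); rewrite trmxK trmx0.
rewrite /dimv [span]unlock mx2vsK -[RHS]mxrank_tr -[RHS](mxrankMfree _ freeP).
suff -> : b2mx (in_tuple X) = castmx (esym szX, erefl) (A^T *m P).
  by case: _ / (esym szX); rewrite castmx_id.
apply/row_matrixP=> i; rewrite rowK (tnth_nth 0) /=.
have -> : row i (castmx (esym szX, erefl) (A^T *m P)) =
          row (cast_ord szX i) (A^T *m P).
  by apply/rowP=> j; rewrite !mxE castmxE /= !mxE esymK cast_ord_id.
rewrite row_mul PE; congr v2r.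
rewrite (nth_map (cast_ord szX i)) ?size_enum_ord ?(ltn_ord (cast_ord szX i)) //.
by rewrite (nth_ord_enum _ (cast_ord szX i)) tr_row trmxK.
Qed.

Lemma affine_dim_convex_hull_balanced (R : realType) (V : vectType R) (N : nat)
    (p : 'I_N -> V) :
  (0 < N)%N -> \sum_i p i = 0 ->
  affine_dim (convex_hull (range p)) = \dim <<[seq p i | i <- enum 'I_N]>>%VS.
Proof.
move=> N_gt0 p0; set W := <<_>>%VS; set A := convex_hull _.
have pW i : p i \in W by rewrite memv_span // map_f // mem_enum.
have pA i : A (p i).
  exists 1%N, (fun=> p i), (fun=> 1); split=> //.
    by rewrite big_ord1.
  by rewrite big_ord1 scale1r.
have AW x : A x -> x \in W.
  move=> [m [q [c [qp _ _ ->]]]]; apply: rpred_sum => k _.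
  by have [i _ <-] := qp k; rewrite rpredZ.
(* Directions are unique, and a nonempty set has one, so exhibiting [W] as a direction suffices;
   [0 < N] gives nonemptiness. *)
suff dW : is_direction A W.
  congr (\dim _); apply: is_direction_inj dW; apply: directionP.
  by exists (p (Ordinal N_gt0)).
exists 0; apply/seteqP; split=> x /=.
  move=> [m [q [c [qA _ ->]]]].
  exists (\sum_i c i *: q i); rewrite ?add0r //=.
  by apply: rpred_sum => k _; rewrite rpredZ ?AW.
move=> [u uW <-]; rewrite add0r.
have [k uE] : exists k : 'I_N -> R, u = \sum_i k i *: p i.
  exists (fun i => coord [tuple of [seq p i | i <- ord_tuple N]] i u).
  rewrite {1}(@coord_span _ _ _ [tuple of [seq p i | i <- ord_tuple N]] u) //.
  by apply: eq_bigr => i _; rewrite -tnth_nth tnth_map tnth_ord_tuple.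
have N0 : N%:R != 0 :> R by rewrite pnatr_eq0 -lt0n.
(* As the [p i] sum to zero, shifting all coefficients only changes their sum. *)
exists N, p, (fun i => k i + (1 - \sum_j k j) / N%:R); split=> //.
  by rewrite big_split /= sumr_const card_ord -[X in _ + X]mulr_natr divfK // addrC subrK.
under eq_bigr do rewrite scalerDl.
by rewrite big_split /= -scaler_sumr p0 scaler0 addr0.
Qed.

Section SpechtMatrix.
Variables (n : nat) (T1 T2 : finType) (w1 : word n T1) (w2 : word n T2).

Lemma word_act_tperm (i j : 'I_n) : w1 i = w1 j -> word_act w1 (tperm i j) = w1.
Proof.
move=> wij; apply/ffunP=> k; rewrite ffunE tpermV.
by case: tpermP => [->|->|].
Qed.

Lemma sum_sign_repeated_letter (i j : 'I_n) (r1 : word n T1) :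
  i != j -> w1 i = w1 j ->
  \sum_(s : 'S_n | word_act w1 s == r1) (-1) ^+ s = 0 :> int.
Proof.
move=> nij wij; set S := \sum_(s | _) _.
have SN : S = - S.
  (* Products in ['S_n] apply the left factor first, so [tperm i j * s] and [s] send [w1] to the
     same word, with opposite signs. *)
  rewrite {1}/S (reindex_inj (mulgI (tperm i j))) /S -sumrN.
  apply: eq_big => [s|s _]; first by rewrite word_actM /= word_act_tperm.
  by rewrite odd_permM odd_tperm nij signr_addb mulN1r.
by apply/eqP; rewrite -[_ == 0](mulrn_eq0 S 2) mulr2n {1}SN addNr.
Qed.

(** Each [s] sends [w2] to exactly one rearrangement, so summing over all of them drops the
    condition on [w2]. *)
Lemma sum_young_character (r1 : word n T1) :
  \sum_(r2 in rearrangements w2) young_character w1 w2 r1 r2 =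
  \sum_(s : 'S_n | word_act w1 s == r1) (-1) ^+ s.
Proof.
rewrite [RHS](partition_big (word_act w2) (mem (rearrangements w2))) //= => s _.
by apply/orbitP; exists s; rewrite ?inE.
Qed.

Lemma sum_col_specht_matrix (K : pzRingType) (i j : 'I_n) :
  i != j -> w1 i = w1 j -> \sum_k col k (specht_matrix w1 w2 K) = 0.
Proof.
move=> nij wij; apply/colP=> r; rewrite summxE mxE.
under eq_bigr do rewrite !mxE.
rewrite -(big_enum_val (fun r2 => (young_character w1 w2 (enum_val r) r2)%:~R)).
by rewrite -rmorph_sum /= sum_young_character (sum_sign_repeated_letter _ nij).
Qed.

(** Entries are images of integers, which every ring morphism preserves. *)
Lemma map_specht_matrix (K L : pzRingType) (f : {rmorphism K -> L}) :
  map_mx f (specht_matrix w1 w2 K) = specht_matrix w1 w2 L.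
Proof. by apply/matrixP=> i j; rewrite !mxE rmorph_int. Qed.

End SpechtMatrix.

(** If no part exceeds 1, the parts, being nonzero, all equal 1, and their number is their sum
    [n]. *)
Lemma is_partition_has_gt1 (n : nat) (lam : seq nat) :
  is_partition n lam -> lam <> nseq n 1%N -> has (ltn 1) lam.
Proof.
move=> /and3P[_ lam_gt0 /eqP sum_lam] lam_neq1; apply/negP=> /negP.
rewrite -all_predC => /allP lam_le1; apply: lam_neq1.
have lam1 : all (pred1 1%N) lam.
  apply/allP=> k lamk; have /= := lam_le1 k lamk; rewrite -leqNgt.
  by case: k lamk => [|[]] // lam0; rewrite lam0 in lam_gt0.
have lamE := all_pred1P _ _ lam1.
by rewrite {1}lamE -sum_lam {2}lamE sumn_nseq mul1n.
Qed.

Lemma multiplicities_gt1 (n : nat) (T : finType) (w : word n T) (k : nat) :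
  (1 < nth 0%N (multiplicities w) k)%N -> exists i j, i != j /\ w i = w j.
Proof.
move=> gt1; have : nth 0%N (multiplicities w) k \in multiplicities w.
  (* Out of range, [nth] would return 0, so a value above 1 forces [k] to be a valid index. *)
  by rewrite mem_nth // ltnNge; apply: contraTN gt1 => /(nth_default 0%N) ->.
rewrite mem_sort => /mapP[a _ eqa]; move: gt1; rewrite eqa => /card_gt1P[i [j []]].
by rewrite !inE => /eqP wi /eqP wj nij; exists i, j; rewrite wi wj.
Qed.

Theorem theorem5p4 (R : realType) (n : nat) (lam : seq nat) (T1 T2 : finType)
    (w1 : word n T1) (w2 : word n T2) :
  (1 <= n)%N ->
  is_partition n lam ->
  lam <> nseq n 1%N ->
  complementary w1 w2 ->
  corresponds_to w1 w2 lam ->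
  affine_dim (specht_polytope R w1 w2) = \dim (specht_module R w1 w2).
Proof.
move=> _ part_lam lam_neq1 _ corr.
have /(has_nthP 0%N)[k _ gt1] := is_partition_has_gt1 part_lam lam_neq1.
have [i [j [nij wij]]] : exists i j, i != j /\ w1 i = w1 j.
  by apply: (@multiplicities_gt1 _ _ _ k); rewrite (corr k).1.
have col_gt0 : (0 < #|rearrangements w2|)%N.
  by apply/card_gt0P; exists w2; apply: orbit_refl.
rewrite affine_dim_convex_hull_balanced ?(sum_col_specht_matrix _ _ nij wij) //.
rewrite /specht_module !dim_span_col.
(* The field embedding of [R] into [R[i]] preserves rank. *)
by rewrite -(map_specht_matrix w1 w2 (real_complex R)) mxrank_map.
Qed.
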